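(* Let $0<b<a$. There exist $n_0=n_0(a/b)$ and a constant $c(a,b)<\pi$ such that the following holds for every $n>n_0$: if $Q(x)=\sum_{j=0}^n c_jx^j$ is any real polynomial of degree $n$ with $|Q(z_0)|=a^n$ for some $z_0\in[-1,1]$, then $$\big|\{\theta\in(0,\pi):\ |Q(\cos\theta)|<b^n\}\big|\le c(a,b).$$
   Context: $|\cdot|$ denotes Lebesgue measure. *)

(* Defs.v *)
From HB Require Import structures.
From mathcomp Require Import all_boot all_order all_algebra.
From mathcomp Require Import all_classical all_reals all_analysis.

(* Main.v *)
(* The classical proof of the Remez inequality. If the exceptional set
   {|Q(cos t)| >= b^n} is short, then so is its image under the 1-Lipschitz map
   cos. From z0 walk towards the farther end of [-1, 1], at distance L >= 1, and
   pick greedily n+1 points where |Q| <= b^n whose consecutive gaps are at least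
   those of the Chebyshev extremal points of [s, L]. The walk is delayed by at
   most the exceptional length, so the points are no farther from z0 than the
   Chebyshev ones. In the Lagrange formula at z0 both effects only decrease the
   weights, and with the Chebyshev points these weights sum to T_n(z), z > 1.
   For z = (r + 1/r)/2 one has T_n(z) = (r^n + r^-n)/2 < r^n. *)
Require Import Defs.
From HB Require Import structures.
From mathcomp Require Import all_boot all_order all_algebra.
From mathcomp Require Import all_classical all_reals all_analysis.
From mathcomp Require Import measurable_realfun lra ring.
Import Order.TTheory GRing.Theory Num.Theory.
Import numFieldNormedType.Exports.
Local Open Scope classical_set_scope.
Local Open Scope ring_scope.

(** * Lagrange interpolation *)

(** The difference of [p] and its interpolant has size at most [N] and vanishes at [N] distinct
    nodes, so it is zero. *)
Lemma horner_lagrange (F : fieldType) (N : nat) (x : nat -> F) (p : {poly F}) (z : F) :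
  {in gtn N &, injective x} -> (size p <= N)%N ->
  p.[z] = \sum_(i < N) p.[x i] * \prod_(j < N | j != i) ((z - x j) / (x i - x j)).
Proof.
move=> x_inj sp.
have xP (i j : 'I_N) : j != i -> x i - x j != 0.
  by rewrite subr_eq0; apply: contraNneq => /x_inj/val_inj->; rewrite ?inE.
pose ell (i : 'I_N) : {poly F} :=
  \prod_(j < N | j != i) ((x i - x j)^-1 *: ('X - (x j)%:P)).
have ellE i y : (ell i).[y] = \prod_(j < N | j != i) ((y - x j) / (x i - x j)).
  by rewrite horner_prod; apply: eq_bigr => j _; rewrite !hornerE mulrC.
have size_ell i : (size (ell i) <= N)%N.
  rewrite /ell scaler_prod (leq_trans (size_scale_leq _ _))// size_prod => [|j _]; last first.
    by rewrite polyXsubC_eq0.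
  under eq_bigr do rewrite size_XsubC.
  rewrite sum_nat_const cardC1 card_ord; case: N i {x_inj sp xP ell ellE} => [[]//|N i].
  by rewrite muln2 -addnn subSn ?leq_addr// addnK.
pose d := p - \sum_(i < N) p.[x i] *: ell i.
suff d0 : d = 0.
  move/eqP: d0; rewrite subr_eq0 => /eqP/(congr1 (horner^~ z)) ->.
  by rewrite horner_sum; apply: eq_bigr => i _; rewrite hornerZ ellE.
apply: (@roots_geq_poly_eq0 _ d [seq x i | i : 'I_N]).
- apply/allP => _ /mapP[i _ ->]; rewrite /root /d hornerD hornerN horner_sum subr_eq0.
  rewrite (bigD1 i)//= hornerZ ellE big1 ?mulr1 => [|j ji]; last by rewrite divff ?xP.
  rewrite big1 ?addr0// => j ji; rewrite hornerZ ellE (bigD1 i) 1?eq_sym//=.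
  by rewrite subrr mul0r mul0r mulr0.
- rewrite map_inj_uniq ?enum_uniq// => i j /x_inj.
  by rewrite !inE !ltn_ord => /(_ isT isT)/val_inj.
- rewrite size_map size_enum_ord (leq_trans (size_polyD _ _))// geq_max sp size_polyN.
  apply: (leq_trans (size_sum _ _ _)); apply/bigmax_leqP => i _.
  exact: leq_trans (size_scale_leq _ _) (size_ell i).
Qed.

(** * Chebyshev polynomials and their extremal points *)

(** The Chebyshev polynomials of the first kind, T_n. *)
Fixpoint cheb (R : comNzRingType) (n : nat) : {poly R} :=
  match n with
  | 0 => 1
  | m.+1 => match m with 0 => 'X | k.+1 => 2 *: ('X * cheb R m) - cheb R k end
  end.

Lemma chebSS (R : comNzRingType) n : cheb R n.+2 = 2 *: ('X * cheb R n.+1) - cheb R n.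
Proof. by []. Qed.

Lemma two_step_ind (P : nat -> Prop) :
  P 0%N -> P 1%N -> (forall n, P n -> P n.+1 -> P n.+2) -> forall n, P n.
Proof.
move=> P0 P1 PSS n; suff [] : P n /\ P n.+1 by [].
by elim: n => // n [? ?]; split; auto.
Qed.

Lemma size_cheb (R : comNzRingType) n : (size (cheb R n) <= n.+1)%N.
Proof.
elim/two_step_ind: n => [||n IH0 IH1]; rewrite ?size_poly1 ?size_polyX//.
rewrite chebSS (leq_trans (size_polyD _ _))// geq_max size_polyN.
rewrite (leq_trans IH0) ?andbT; last by rewrite ltnS leqW.
rewrite (leq_trans (size_scale_leq _ _))// (leq_trans (size_polyMleq _ _))//.
by rewrite size_polyX.
Qed.

Lemma cheb_cos (R : realType) n (x : R) : (cheb R n).[cos x] = cos (n%:R * x).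
Proof.
elim/two_step_ind: n => [||n IH0 IH1].
- by rewrite hornerE mul0r cos0.
- by rewrite hornerX mul1r.
rewrite chebSS hornerD hornerN hornerZ hornerM hornerX IH0 IH1.
have -> : n%:R * x = n.+1%:R * x - x by rewrite -natr1; ring.
have -> : n.+2%:R * x = n.+1%:R * x + x by rewrite -natr1; ring.
by rewrite cosB cosD; ring.
Qed.

(** Both sides obey the Chebyshev recurrence. With real [w > 1] this evaluates T_n to the right of
    1, out of reach of [cheb_cos]. *)
Lemma cheb_joukowski (F : numFieldType) n (w : F) : w != 0 ->
  (cheb F n).[(w + w^-1) / 2] = (w ^+ n + w ^- n) / 2.
Proof.
move=> w0; elim/two_step_ind: n => [||n IH0 IH1].
- by rewrite hornerE expr0 invr1 -mulr2n divff.
- by rewrite hornerX expr1.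
rewrite chebSS hornerD hornerN hornerZ hornerM hornerX IH0 IH1 !exprS.
by field; rewrite w0 expf_neq0.
Qed.

(* The extremal points of T_n, in decreasing order. *)
Definition cheb_node (R : realType) (n i : nat) : R := cos (i%:R / n%:R * pi).

Lemma cheb_node_lt (R : realType) n i j : (i < j <= n)%N ->
  cheb_node R n j < cheb_node R n i.
Proof.
move=> /andP[ij jn]; have n0 : (0 : R) < n%:R.
  by rewrite ltr0n (leq_ltn_trans _ (leq_trans ij jn)).
have node_itv k : (k <= n)%N -> (k%:R / n%:R * pi : R) \in `[0, pi].
  move=> kn; rewrite in_itv/= mulr_ge0 ?divr_ge0 ?pi_ge0//=.
  by rewrite ler_piMl ?pi_ge0// ler_pdivrMr// mul1r ler_nat.
rewrite /cheb_node ltr_cos ?node_itv//; last exact: leq_trans (ltnW ij) jn.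
by rewrite ltr_pM2r ?pi_gt0// ltr_pM2r ?invr_gt0// ltr_nat.
Qed.

Lemma cheb_cheb_node (R : realType) n i : (0 < n)%N ->
  (cheb R n).[cheb_node R n i] = (-1) ^+ i.
Proof.
move=> n0; rewrite /cheb_node cheb_cos mulrA mulrCA divff ?pnatr_eq0 -?lt0n// mulr1.
elim: i => [|i IH]; first by rewrite mul0r cos0.
by rewrite -natr1 mulrDl mul1r cosDpi IH exprS mulN1r.
Qed.

(* The values (-1)^i of T_n at its extremal points cancel the signs of the
   denominators in the Lagrange formula. *)
Lemma cheb_lagrange_norm (R : realType) n (z : R) : (0 < n)%N ->
  (cheb R n).[z] = \sum_(i < n.+1) \prod_(j < n.+1 | j != i)
     ((z - cheb_node R n j) / `|cheb_node R n i - cheb_node R n j|).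
Proof.
move=> n0; rewrite (@horner_lagrange _ n.+1 (cheb_node R n) _ z); last 2 first.
- move=> i j; rewrite !inE !ltnS => iN jN /eqP; case: (ltngtP i j) => // ij.
    by rewrite gt_eqF// cheb_node_lt// ij.
  by rewrite lt_eqF// cheb_node_lt// ij.
- exact: size_cheb.
apply: eq_bigr => i _; rewrite cheb_cheb_node//.
(* One sign goes to each [j < i]; as the nodes decrease, these are the factors with a negative
   denominator. *)
have -> : (-1) ^+ i = \prod_(j < n.+1 | j != i) (if (j < i)%N then -1 else 1) :> R.
  rewrite -[X in _ ^+ X]card_ord -prodr_const.
  rewrite (big_ord_widen n.+1 (fun=> -1)) ?(ltnW (ltn_ord i))//.
  rewrite -big_mkcondr; apply: eq_bigl => j; rewrite -[j != i]/(val j != val i).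
  by case: ltngtP.
rewrite -big_split; apply: eq_bigr => j ji /=.
have : (val j == val i) = false by apply/negbTE.
case: ltngtP => //= ij _; rewrite ?mulN1r ?mul1r.
  by rewrite ltr0_norm ?invrN ?mulrN// subr_lt0 cheb_node_lt// ij -ltnS ltn_ord.
by rewrite gtr0_norm// subr_gt0 cheb_node_lt// ij -ltnS ltn_ord.
Qed.

(** * Greedy choice of sublevel points and the bound at an endpoint *)

(* G x plays the role of the length of {f > m} to the left of x. *)
Definition controls_superlevel (R : realType) (f G : R -> R) (m L : R) :=
  {homo G : x y / x <= y} /\
  forall p q, 0 <= p -> p < q -> q <= L ->
    (forall x, p < x < q -> m < f x) -> q - p <= G q - G p.

(** Take for [t] the leftmost sublevel point of [p, L], found by compactness: [f > m] on ]p, t[, so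
    [G] pays for the delay. Without any sublevel point, [G] would have to grow by [L - p]. *)
Lemma next_sublevel_point (R : realType) (f G : R -> R) (m L p : R) :
  continuous f -> controls_superlevel R f G m L ->
  0 <= p -> p <= L -> G L - G p < L - p ->
  exists t, [/\ p <= t <= L, f t <= m & t - p <= G t - G p].
Proof.
move=> fc [Gmono Gf] p0 pL GL.
pose A := `[p, L] `&` f @^-1` [set y | y <= m].
have A0 : A !=set0.
  apply: contrapT => /set0P/negP/negPn/eqP A0.
  have pltL : p < L by rewrite -subr_gt0 (le_lt_trans _ GL)// subr_ge0 Gmono.
  move: GL; rewrite ltNge => /negP; apply; apply: Gf => // x /andP[px xL].
  rewrite ltNge; apply/negP => fx.
  suff : A x by rewrite A0.
  by split => //=; rewrite in_itv/= !ltW.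
have cA : compact A.
  apply: compact_closedI; first exact: segment_compact.
  by apply: preimage_closed => //; exact: closed_le.
have [t] := @compact_EVT_min R R id A A0 cA (continuous_subspaceT (fun x => cvg_id)).
rewrite inE => -[/=]; rewrite in_itv/= => /andP[pt tL] ft tmin.
exists t; split => //; first by rewrite pt.
move: pt; rewrite le_eqVlt => /predU1P[->|pt]; first by rewrite !subrr.
apply: Gf => // x /andP[px xt]; rewrite ltNge; apply/negP => fx.
have : x \in A.
  by rewrite inE; split => //=; rewrite in_itv/= (ltW px) (le_trans (ltW xt)).
by move/tmin; rewrite leNgt xt.
Qed.

Lemma spread_sublevel_points (R : realType) (f G : R -> R) (m L : R)
    (n : nat) (v : nat -> R) :
  continuous f -> controls_superlevel R f G m L -> 0 <= L ->
  (forall i j, (i < j <= n)%N -> v i < v j) ->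
  G L - G 0 < v 0%N -> v n <= L ->
  exists t : nat -> R,
    (forall i, (i <= n)%N -> 0 <= t i <= v i /\ f (t i) <= m) /\
    (forall i j, (i < j <= n)%N -> v j - v i <= t j - t i).
Proof.
move=> fc Gf L0 vlt Gv vL.
have Gmono : {homo G : x y / x <= y} by case: Gf.
have viL i : (i <= n)%N -> v i <= L.
  move=> iN; apply: le_trans vL; move: iN; rewrite leq_eqVlt => /predU1P[->//|iN].
  by rewrite ltW// vlt// iN/=.
(* The delay is measured by the growth of [G] up to [t i] only, so that successive delays telescope;
   bounding it by [G L - G 0 < v 0] at the end gives [t i <= v i]. *)
suff ind : forall k, (k <= n)%N -> exists t : nat -> R,
    (forall i, (i <= k)%N -> [/\ 0 <= t i, t i <= L, f (t i) <= m
       & t i <= v i - v 0%N + (G (t i) - G 0)]) /\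
    (forall i j, (i < j <= k)%N -> v j - v i <= t j - t i).
  have [t [tP tD]] := ind n (leqnn n).
  exists t; split => // i iN; have [t0 tL ft tv] := tP i iN; split=> //.
  by have := Gmono _ _ tL; lra.
elim=> [_|k IH kn].
  have [//||t [/andP[t0 tL] ft tG]] := @next_sublevel_point R f G m L 0 fc Gf (lexx 0).
    by have := viL 0%N isT; lra.
  exists (fun=> t); split => [i|i j]; last by case/andP; case: j.
  by rewrite leqn0 => /eqP->; split => //; lra.
have [t [tP tD]] := IH (ltnW kn).
have [tk0 tkL ftk tkv] := tP k (leqnn k).
have vk : v k < v k.+1 by rewrite vlt// leqnn.
have vkL := viL _ kn.
(* The earliest position that respects the required gap; the invariant and [G L - G 0 < v 0] ensure
   that a sublevel point remains in [p, L]. *)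
pose p := t k + (v k.+1 - v k).
have tkp : t k <= p by rewrite /p; lra.
have Gp := Gmono _ _ tkp; have GkL := Gmono _ _ tkL.
have pL : p <= L by rewrite /p; lra.
have [|//||s [/andP[ps sL] fs sG]] := @next_sublevel_point R f G m L p fc Gf.
- exact: le_trans tkp.
- by rewrite /p; lra.
exists (fun i => if (i <= k)%N then t i else s); split => [i|i j].
  rewrite leq_eqVlt ltnS => /predU1P[->|ik]; last by rewrite ik; exact: tP.
  by rewrite ltnn; split => //; [lra|rewrite /p in sG ps Gp *; lra].
move=> /andP[ij]; rewrite leq_eqVlt ltnS => /predU1P[jE|jk]; last first.
  by rewrite jk (ltnW (leq_trans ij jk)); apply: tD; rewrite ij.
move: ij; rewrite jE ltnS ltnn => ik; rewrite ik.
suff : v k - v i <= t k - t i by rewrite /p in ps; lra.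
move: ik; rewrite leq_eqVlt => /predU1P[->|ik]; first by rewrite !subrr.
by apply: tD; rewrite ik /=.
Qed.

Lemma remez_endpoint (R : realType) (P : {poly R}) (G : R -> R) (m L z : R) (n : nat) :
  (0 < n)%N -> (size P <= n.+1)%N -> 0 <= m -> 0 < L -> 1 < z ->
  controls_superlevel R (fun x => `|P.[x]|) G m L ->
  G L - G 0 < L * ((z - 1) / (z + 1)) ->
  `|P.[0]| <= m * (cheb R n).[z].
Proof.
move=> n0 sP m0 L0 z1 Gf GL.
(* v_i = l (z - y_i) are the extremal points transported to an interval ending at L *)
pose l := L / (1 + z); have l0 : 0 < l by rewrite divr_gt0//; lra.
pose v i := l * (z - cheb_node R n i).
have vlt i j : (i < j <= n)%N -> v i < v j.
  by move=> ij; rewrite ltr_pM2l// ltrD2l ltrN2 cheb_node_lt.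
have fc : continuous (fun x => `|P.[x]|).
  by move=> x; apply: cvg_norm; exact: continuous_horner.
(* The extreme nodes 1 and -1 give [v 0 = L * ((z - 1) / (z + 1))], the allowed delay, and
   [v n = L]. *)
have [||t [tP tD]] := @spread_sublevel_points R _ G m L n v fc Gf (ltW L0) vlt.
- rewrite /v /cheb_node mul0r mul0r cos0 (lt_le_trans GL)// /l.
  by rewrite mulrA [X in _ <= X]mulrAC [1 + z]addrC.
- rewrite /v /cheb_node divff ?pnatr_eq0 -?lt0n// mul1r cospi /l opprK [z + 1]addrC.
  by rewrite divfK// gt_eqF//; lra.
rewrite (@horner_lagrange _ n.+1 t _ 0)//; last first.
  move=> i j; rewrite !inE !ltnS => iN jN tij; case: (ltngtP i j) => // ij.
  - have /vlt vij : (i < j <= n)%N by rewrite ij.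
    by have := tD i j; rewrite ij jN tij subrr subr_le0 leNgt vij => /(_ isT).
  - have /vlt vij : (j < i <= n)%N by rewrite ij.
    by have := tD j i; rewrite ij iN tij subrr subr_le0 leNgt vij => /(_ isT).
rewrite cheb_lagrange_norm// mulr_sumr (le_trans (ler_norm_sum _ _ _))//.
apply: ler_sum => i _; rewrite normrM ler_pM//.
  by case: (tP i (leq_ord i)).
rewrite normr_prod; apply: ler_prod => j ji; rewrite normr_ge0/=.
have [/andP[tj0 tjv] _] := tP j (leq_ord j).
rewrite sub0r normrM normrN normfV (ger0_norm tj0).
(* Lagrange weights are invariant under affine maps: the scale [l] cancels. *)
have -> : (z - cheb_node R n j) / `|cheb_node R n i - cheb_node R n j| = v j / `|v i - v j|.
  rewrite /v -mulrBr normrM (gtr0_norm l0).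
  rewrite (_ : z - _ - _ = cheb_node R n j - cheb_node R n i) 1?distrC; last by ring.
  by rewrite -mulf_div divff ?gt_eqF// mul1r.
have vt (a b : nat) : (a < b <= n)%N -> 0 < `|v a - v b| <= `|t a - t b|.
  move=> ab; have := vlt _ _ ab; have := tD _ _ ab => tab vab.
  have va : v a - v b < 0 by rewrite subr_lt0.
  have ta : t a - t b < 0 by rewrite subr_lt0 -subr_gt0 (lt_le_trans _ tab)// subr_gt0.
  by rewrite !ltr0_norm// !opprB subr_gt0 vab tab.
have /andP[v0 vt0] : 0 < `|v i - v j| <= `|t i - t j|.
  have := ji; rewrite -(inj_eq val_inj) neq_ltn => /orP[] ij.
    by rewrite distrC [`|t i - _|]distrC vt// ij leq_ord.
  by rewrite vt// ij leq_ord.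
by rewrite ler_pM ?invr_ge0// lef_pV2// posrE (lt_le_trans v0).
Qed.

(** * Transport of length by the cosine *)

Lemma cosB_le (R : realType) (x y : R) : x <= y -> cos x - cos y <= y - x.
Proof.
move=> xy.
have [|c _ E] := @MVT_segment R (@cos R) (fun t => - sin t) x y xy.
  by apply: continuous_subspaceT; exact: continuous_cos.
by rewrite -opprB E mulNr opprK ler_piMl ?subr_ge0// sin_le1.
Qed.

(** The distribution function of the image under [cos] of Lebesgue measure on [D]. It is used for
    [D] inside ]0, pi[, where the measure is finite and [fine] loses nothing. *)
Definition cos_cdf (R : realType) (D : set R) (x : R) : R :=
  fine (lebesgue_measure (D `&` [set t | cos t <= x])).

Section cos_cdf.
Context (R : realType) (D : set R).
Hypotheses (mD : measurable D) (D0pi : D `<=` `]0, pi[).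

Let mDcos x : measurable (D `&` [set t | cos t <= x]).
Proof.
apply: measurableI => //.
have -> : [set t | cos t <= x] = @cos R @^-1` [set y | y <= x] by [].
apply: closed_measurable; apply: preimage_closed; last exact: closed_le.
by move=> t _; exact: continuous_cos.
Qed.

Let Dfin (A : set R) : measurable A -> A `<=` D -> lebesgue_measure A \is a fin_num.
Proof.
move=> mA AD; rewrite ge0_fin_numE//.
apply: (@le_lt_trans _ _ (lebesgue_measure (`]0, pi[ : set R))).
  by apply: le_measure; rewrite ?inE//; exact: subset_trans D0pi.
by rewrite lebesgue_measure_itv/= lte_fin pi_gt0 -EFinD ltry.
Qed.

Lemma cos_cdf_ge0 x : 0 <= cos_cdf R D x.
Proof. exact: fine_ge0. Qed.

Lemma cos_cdf_le x : ((cos_cdf R D x)%:E <= lebesgue_measure D)%E.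
Proof.
rewrite fineK ?Dfin//.
by apply: le_measure; rewrite ?inE//; exact: mDcos.
Qed.

Lemma cos_cdf_homo : {homo cos_cdf R D : x y / x <= y}.
Proof.
move=> x y xy; rewrite fine_le ?Dfin//.
apply: le_measure; rewrite ?inE; [exact: mDcos..|].
by apply: setIS => t /= /le_trans; apply.
Qed.

(** The interval ]acos y, acos x[ lies in [D] and misses the angles with [cos t <= x], so its whole
    length is added; that length is at least [y - x] by [cosB_le]. *)
Lemma cos_cdf_increment x y : -1 <= x -> x < y -> y <= 1 ->
  (forall t, 0 < t < pi -> x < cos t < y -> D t) ->
  y - x <= cos_cdf R D y - cos_cdf R D x.
Proof.
move=> x1 xy y1 HD.
have xI : x \in `[-1, 1] by rewrite in_itv/= x1 (le_trans (ltW xy)).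
have yI : y \in `[-1, 1] by rewrite in_itv/= y1 (le_trans x1 (ltW xy)).
have acI (z : R) : z \in `[-1, 1] -> acos z \in `[0, pi].
  by rewrite !in_itv/= => zI; rewrite acos_ge0 ?acos_lepi.
have xyacos : acos y < acos x by rewrite -ltr_cos ?acI// !acosK.
pose J : set R := `]acos y, acos x[%classic.
have JP t : J t -> 0 < t < pi /\ x < cos t < y.
  rewrite /J/= in_itv/= => /andP[yt tx].
  have /acI := xI; have /acI := yI; rewrite !in_itv/= => /andP[ay0 _] /andP[_ axpi].
  have t0 : 0 < t by exact: le_lt_trans yt.
  have tpi : t < pi by exact: lt_le_trans axpi.
  have tI : t \in `[0, pi] by rewrite in_itv/= !ltW.
  split; first by rewrite t0.
  rewrite -(acosK xI) -(acosK yI).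
  by rewrite !ltr_cos ?acI// tx.
have JD : J `<=` D by move=> t /JP[? ?]; exact: HD.
have mJ : measurable J by exact: measurable_itv.
have JlE : lebesgue_measure J = (acos x - acos y)%:E.
  by rewrite /J lebesgue_measure_itv/= lte_fin xyacos -EFinD.
have dsum : cos_cdf R D x + (acos x - acos y) <= cos_cdf R D y.
  rewrite -lee_fin EFinD -JlE !fineK ?Dfin//.
  rewrite -measureU; [|exact: mDcos|exact: mJ|]; last first.
    by apply/seteqP; split=> // t /= [[_ tx] /JP[_ /andP[]]]; rewrite ltNge tx.
  apply: le_measure; rewrite ?inE; [|exact: mDcos|].
    by apply: measurableU; [exact: mDcos|exact: mJ].
  move=> t /= [[Dt tx]|Jt]; first by split => //; exact: le_trans (ltW xy).
  by split; [exact: JD|have [_ /andP[_ /ltW]] := JP _ Jt].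
have := @cosB_le R _ _ (ltW xyacos); rewrite !acosK//.
by move: dsum; lra.
Qed.

End cos_cdf.

(** * The Remez inequality on [-1, 1] and the theorem *)

Lemma remez_cos (R : realType) (Q : {poly R}) (D : set R) (m z z0 : R) (n : nat) :
  (0 < n)%N -> (size Q <= n.+1)%N -> 0 <= m -> 1 < z ->
  measurable D -> D `<=` `]0, pi[ ->
  (forall t, 0 < t < pi -> m < `|Q.[cos t]| -> D t) ->
  (lebesgue_measure D < ((z - 1) / (z + 1))%:E)%E ->
  -1 <= z0 <= 1 -> `|Q.[z0]| <= m * (cheb R n).[z].
Proof.
move=> n0 sQ m0 z1 mD D0pi HD muD /andP[z0N1 z01].
set k := (z - 1) / (z + 1) in muD *.
have k0 : 0 < k by rewrite divr_gt0//; lra.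
have G0 := @cos_cdf_ge0 R D.
have Gk x : cos_cdf R D x < k.
  by rewrite -lte_fin (le_lt_trans _ muD)// cos_cdf_le.
have Gm := @cos_cdf_homo R D mD D0pi.
have Ginc x y : -1 <= x -> x < y -> y <= 1 -> (forall u, x < u < y -> m < `|Q.[u]|) ->
    y - x <= cos_cdf R D y - cos_cdf R D x.
  move=> x1 xy y1 H; apply: cos_cdf_increment => // t t0pi /H; exact: HD.
have size_comp (s : R) : (size (Q \Po (z0%:P + s *: 'X)) <= n.+1)%N.
  apply: leq_trans (size_comp_poly_leq _ _) _; rewrite ltnS.
  have size_affine : (size (z0%:P + s *: 'X)%R <= 2)%N.
    rewrite (leq_trans (size_polyD _ _))// geq_max (leq_trans (size_polyC_leq1 _))//=.
    by rewrite (leq_trans (size_scale_leq _ _))// size_polyX.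
  by rewrite -[n]muln1 leq_mul// -subn1 leq_subLR.
have horner_affine (s t : R) : (Q \Po (z0%:P + s *: 'X)).[t] = Q.[z0 + s * t].
  by rewrite horner_comp hornerD hornerC hornerZ hornerX.
have Q0 (s : R) : Q.[z0] = (Q \Po (z0%:P + s *: 'X)).[0].
  by rewrite horner_affine mulr0 addr0.
case: (leP 0 z0) => z00.
- rewrite (Q0 (-1)).
  (* The farther end is -1, so the walk is reflected; the minus sign keeps [G] nondecreasing. *)
  apply: (@remez_endpoint _ _ (fun x => - cos_cdf R D (z0 - x)) m (1 + z0)) => //.
  + by lra.
  + split=> [x y xy|p q p0 pq qL H]; first by rewrite lerN2 Gm// lerD2l lerN2.
    have qp : q - p = z0 - p - (z0 - q) by ring.
    rewrite qp opprK [X in _ <= X]addrC; apply: Ginc; [lra..|] => u uI.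
    have -> : u = z0 + -1 * (z0 - u) by ring.
    by rewrite -horner_affine; apply: H; lra.
  + rewrite subr0 (@lt_le_trans _ _ k)//; last by rewrite ler_peMl ?(ltW k0)//; lra.
    by have := Gk z0; have := G0 (z0 - (1 + z0)); lra.
- rewrite (Q0 1).
  apply: (@remez_endpoint _ _ (fun x => cos_cdf R D (z0 + x)) m (1 - z0)) => //.
  + by lra.
  + split=> [x y xy|p q p0 pq qL H]; first by rewrite Gm// lerD2l.
    have qp : q - p = z0 + q - (z0 + p) by ring.
    rewrite qp; apply: Ginc; [lra..|] => u uI.
    have -> : u = z0 + 1 * (u - z0) by ring.
    by rewrite -horner_affine; apply: H; lra.
  + rewrite (@lt_le_trans _ _ k)//; last by rewrite ler_peMl ?(ltW k0)//; lra.
    by have := Gk (z0 + (1 - z0)); have := G0 (z0 + 0); lra.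
Qed.

(* n0 depends only on the ratio r = a/b; c depends on (a,b). *)
Theorem theorem8 (R : realType) :
  forall r : R, 1 < r ->
  exists n0 : nat, forall a b : R, 0 < b -> a = r * b ->
  exists c : R, c < pi /\
    forall (n : nat), (n0 < n)%N ->
    forall Q : {poly R}, size Q = n.+1 ->
    (exists z0 : R, -1 <= z0 <= 1 /\ `|Q.[z0]| = a ^+ n) ->
    (lebesgue_measure [set theta : R | ((0 < theta < pi) /\ (`|Q.[cos theta]| < b ^+ n))%R]
      <= c%:E)%E.
Proof.
move=> r r1; exists 0%N => a b b0 ->.
have r0 : 0 < r by exact: lt_trans r1.
(* Chosen so that [cheb_joukowski] gives T_n(z) = (r^n + r^-n) / 2. *)
pose z := (r + r^-1) / 2.
have z1 : 1 < z.
  have : 0 < (r - 1) ^+ 2 / r by rewrite divr_gt0// exprn_gt0// subr_gt0.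
  have -> : (r - 1) ^+ 2 / r = (z - 1) * 2 by rewrite /z; field; rewrite gt_eqF.
  lra.
pose k := (z - 1) / (z + 1).
have k0 : 0 < k by rewrite divr_gt0//; lra.
(* If the sublevel set had measure above [pi - k], its complement [D] in ]0, pi[ would have measure
   below [k], the threshold in [remez_cos]. *)
exists (pi - k); split; first by rewrite gtrBl.
move=> n n0 Q sQ [z0 [z0I Qz0]].
set E := [set _ | _]; rewrite leNgt; apply/negP => muE.
pose f (t : R) := `|Q.[cos t]|.
have fc : continuous f.
  move=> t; apply: cvg_norm; apply: continuous_comp; first exact: continuous_cos.
  exact: continuous_horner.
pose I : set R := `]0, pi[%classic.
have EE : E = I `&` f @^-1` [set y | y < b ^+ n].
  by apply/seteqP; split => t /=; rewrite /I/= in_itv.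
have mE : measurable E.
  rewrite EE; apply: measurableI; first exact: measurable_itv.
  apply: open_measurable; apply: open_comp => // ; exact: open_lt.
pose D := I `\` E.
have mI : measurable I by exact: measurable_itv.
have mD : measurable D by exact: measurableD.
have muI : lebesgue_measure I = (pi : R)%:E.
  by rewrite /I lebesgue_measure_itv/= lte_fin pi_gt0 -EFinD subr0.
have EI : E `<=` I by rewrite EE; exact: subIsetl.
have muDE : (lebesgue_measure I = lebesgue_measure E + lebesgue_measure D)%E.
  rewrite -measureU//; last by rewrite /D setDE setICA setICr setI0.
  by rewrite /D setDUK.
have muD : (lebesgue_measure D < k%:E)%E.
  have : (lebesgue_measure E <= pi%:E)%E by rewrite -muI muDE leeDl.
  have : (lebesgue_measure D <= pi%:E)%E by rewrite -muI muDE leeDr.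
  move: (measure_ge0 lebesgue_measure D) (measure_ge0 lebesgue_measure E).
  move: muDE muE; rewrite muI.
  case: (lebesgue_measure E) => [e| |]//; case: (lebesgue_measure D) => [d| |]//=.
  by rewrite !lte_fin -EFinD => -[piE] + _ _ _ _; lra.
(* Divided by [b ^+ n], this bound says r^n <= (r^n + r^-n) / 2, which contradicts r^-n < 1 <
   r^n. *)
suff : `|Q.[z0]| <= b ^+ n * (cheb R n).[z].
  rewrite Qz0 exprMn mulrC ler_pM2l ?exprn_gt0// cheb_joukowski ?gt_eqF//.
  rewrite leNgt => /negP; apply; rewrite -subr_gt0.
  have rn : 1 < r ^+ n by rewrite exprn_egt1// -lt0n.
  have : r ^- n < 1 by rewrite invf_lt1// (lt_trans _ rn).
  lra.
apply: (@remez_cos R Q D) => //.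
- by rewrite sQ.
- by rewrite exprn_ge0// ltW.
- by move=> t [].
- move=> t tI mQ; split; first by rewrite /I/= in_itv.
  by case=> _; rewrite ltNge (ltW mQ).
Qed.
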